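(* Let $P=\{p_1<p_2<\cdots\}$ be an infinite set of primes, and let \[ \mathcal{S}(P):=\Bigl\{\prod_j p_j^{e_j} : 0\le e_j\le 3\Bigr\},\qquad A_P(x):=\#\bigl(\mathcal{S}(P)\cap[1,x]\bigr), \] where the products are finite (all but finitely many $e_j$ are $0$). If $A_P(x)=o(\log x)$ as $x\to\infty$, then $\#\{p\in P : p\le x\}=O(\log\log x)$ as $x\to\infty$. *)

(* Defs.v *)
From mathcomp Require Import all_boot all_order all_algebra.
From mathcomp Require Import finmap.
From mathcomp Require Import all_classical all_reals all_analysis.

Set Implicit Arguments.
Unset Strict Implicit.
Unset Printing Implicit Defensive.

Import Order.TTheory GRing.Theory Num.Theory.
Import numFieldNormedType.Exports.

Local Open Scope classical_set_scope.
Local Open Scope ring_scope.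

(* Lets [+oo] be used as the filter in Landau notations. *)
Canonical pinfty_filter_on (R : numFieldType) :=
  FilterType (pinfty_nbhs R) (@filter_filter _ (pinfty_nbhs R) _).

(* The exponents are indexed by the primes of [P] themselves, [e (p_j)] being
   the exponent [e_j]; values of [e] outside [P] are irrelevant.  For [P] a set
   of primes, the [\big] operator below ranges over the [q] of [P] with
   [e q != 0], a finite set by the second condition. *)
Definition calS (P : set nat) : set nat :=
  [set n | exists e : nat -> nat,
    [/\ forall q, P q -> (e q <= 3)%N,
        finite_set [set q | P q /\ e q != 0%N]
      & n = \big[muln/1%N]_(q \in P) (q ^ e q)%N]].

(* [fset_set] returns the empty set on infinite sets; the sets counted below
   are always finite, being bounded sets of natural numbers. *)
Definition countS (R : realType) (P : set nat) (x : R) : nat :=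
  #|` fset_set (calS P `&` [set n | (n%:R : R) \in `[1, x]]) |.

Definition count_le (R : realType) (P : set nat) (x : R) : nat :=
  #|` fset_set [set p | P p /\ p%:R <= x] |.

(* Main.v *)
Require Import Defs.
From mathcomp Require Import all_boot all_order all_algebra.
From mathcomp Require Import finmap.
From mathcomp Require Import all_classical all_reals all_analysis.
From mathcomp Require Import zify.

Import Order.TTheory GRing.Theory Num.Theory.
Import numFieldNormedType.Exports.

Local Open Scope classical_set_scope.
Local Open Scope ring_scope.

(** Let [k] be the number of primes of [P] up to [x].  The products of distinct
    primes among these [k] primes are [2 ^ k] different elements of [calS P],
    each at most [x ^ k]; hence [2 ^ k <= A_P (x ^ k)]
    ([expn_count_le_countS]).  As [A_P y <= ln y] for large [y], this gives
    [2 ^ k <= k * ln x].  The factor [k] is negligible against [2 ^ k]: since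
    [k ^ 2 <= 2 * 2 ^ k], squaring yields [2 ^ k <= 2 * (ln x) ^ 2]
    ([expn_le_sqr]), and taking logarithms bounds [k] by a multiple of
    [ln (ln x)]. *)

Lemma finite_nat_le (R : realType) (y : R) : finite_set [set n : nat | n%:R <= y].
Proof.
apply: (@sub_finite_set _ _ `I_(Num.truncn y).+1); last exact: finite_II.
move=> n /= ny; rewrite -(ltr_nat R).
exact: le_lt_trans ny (truncnS_gt y).
Qed.

Lemma prime_dvd_prod_fset (D : {fset nat}) (p : nat) :
  (forall q, q \in D -> prime q) -> prime p ->
  (p %| \prod_(q <- D) q)%N = (p \in D).
Proof.
move=> Dprime p_prime; rewrite Euclid_dvd_prod// big_has.
apply/hasP/idP => [[q qD]|pD]; last by exists p.
by rewrite dvdn_prime2 ?(Dprime q)// => /eqP ->.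
Qed.

Lemma prod_fset_primes_inj (A B : {fset nat}) :
  (forall q, q \in A -> prime q) -> (forall q, q \in B -> prime q) ->
  (\prod_(q <- A) q = \prod_(q <- B) q)%N -> A = B.
Proof.
move=> Aprime Bprime eqAB; apply/fsetP => p.
have [p_prime|p_nprime] := boolP (prime p).
  by rewrite -!prime_dvd_prod_fset// eqAB.
by rewrite (contraNF (Aprime p) p_nprime) (contraNF (Bprime p) p_nprime).
Qed.

Lemma prod_fset_calS (P : set nat) (D : {fset nat}) :
  [set` D] `<=` P -> calS P (\prod_(q <- D) q)%N.
Proof.
move=> DP; exists (fun q => nat_of_bool (q \in D)); split.
- by move=> q _; case: (q \in D).
- apply: sub_finite_set (finite_fset D) => q [_] /=.
  by case: (q \in D).
- rewrite (@fsbigE _ _ _ _ _ (D : seq nat))//.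
  + rewrite [RHS]big_seq_cond [LHS]big_seq; apply: congr_big => // q.
      by case: (boolP (q \in D)) => //= qD; rewrite mem_set//; exact: DP.
    by move=> ->; rewrite expn1.
  + by move=> q _ qD; rewrite (negbTE qD).
Qed.

Lemma prod_fset_le_expn (R : realType) (D : {fset nat}) (x : R) :
  (forall q, q \in D -> q%:R <= x) -> (\prod_(q <- D) q)%:R <= x ^+ #|` D|.
Proof.
move=> Dx; rewrite natr_prod.
rewrite -[leRHS](_ : \prod_(q <- D) x = _); last first.
  by rewrite big_const_seq count_predT iter_mulr_1.
by rewrite big_seq [leRHS]big_seq; apply: ler_prod => q qD; rewrite ler0n Dx.
Qed.

(** The squarefree products supported on the primes of [P] up to [x] are
    pairwise distinct by unique factorization, and each has at most as many
    factors, all at most [x], as there are such primes. *)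
Lemma expn_count_le_countS (R : realType) (P : set nat) (x : R) :
  (forall p, P p -> prime p) -> 1 <= x ->
  (2 ^ count_le P x <= countS P (x ^+ count_le P x))%N.
Proof.
move=> P_prime x1; rewrite /count_le.
set F := fset_set _.
have inF q : q \in F -> P q /\ q%:R <= x.
  rewrite in_fset_set ?inE//.
  by apply: sub_finite_set (finite_nat_le _ x) => n [].
have Dprime D q : D \in fpowerset F -> q \in D -> prime q.
  by rewrite fpowersetE => /fsubsetP DF /DF /inF[/P_prime].
rewrite -card_fpowerset /countS.
rewrite -(@card_in_imfset imfset_key _ _ (fun D : {fset nat} => \prod_(q <- D) q)%N
           (mem (fpowerset F))) /=; last first.
  move=> A B AF BF; apply: prod_fset_primes_inj => q; exact: Dprime.
apply: fsubset_leq_card; apply/fsubsetP => _ /imfsetP[/= D DF ->].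
rewrite in_fset_set; last first.
  apply: sub_finite_set (finite_nat_le _ (x ^+ #|` F|)) => n [_] /=.
  by rewrite in_itv => /andP[].
have DsubF : (D `<=` F)%fset by rewrite -fpowersetE.
rewrite inE; split.
  by apply: prod_fset_calS => q /(fsubsetP DsubF)/inF[].
rewrite /= in_itv /=; apply/andP; split.
  rewrite ler1n big_seq prodn_cond_gt0// => q qD.
  by rewrite prime_gt0// (Dprime D).
apply: (le_trans (prod_fset_le_expn _ _ x _)) => [q /(fsubsetP DsubF)/inF[]//|].
by apply: ler_weXn2l => //; exact: fsubset_leq_card.
Qed.

Lemma sqrn_le_double_expn2 (k : nat) : (k ^ 2 <= (2 ^ k).*2)%N.
Proof.
(* The step needs (k + 1) ^ 2 <= 2 * k ^ 2, which holds from k = 3 on. *)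
elim: k => // -[|[|[|k]]] // IH.
rewrite [(2 ^ _)%N]expnS mul2n; apply: leq_trans (_ : (k.+3 ^ 2).*2 <= _)%N.
  by rewrite -mul2n !expnS !expn0 !muln1; lia.
by rewrite leq_double.
Qed.

(** Squaring the hypothesis turns the factor [k] into [k ^ 2 <= 2 * 2 ^ k], and
    one of the two powers [2 ^ k] then cancels.  The conclusion is free of [k]
    on the right, so that its logarithm bounds [k]. *)
Lemma expn_le_sqr (R : realDomainType) (k : nat) (L : R) :
  0 <= L -> 2 ^+ k <= k%:R * L -> 2 ^+ k <= 2 * L ^+ 2.
Proof.
move=> L0 kL; have k2 : 0 < 2 ^+ k :> R by rewrite exprn_gt0.
have sq : k%:R ^+ 2 <= 2 * 2 ^+ k :> R.
  by rewrite -!natrX -natrM ler_nat mul2n sqrn_le_double_expn2.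
rewrite -(ler_pM2l k2) -expr2.
apply: (@le_trans _ _ ((k%:R * L) ^+ 2)).
  by rewrite lerXn2r// ?nnegrE ?mulr_ge0// ltW.
rewrite exprMn [leRHS]mulrA [2 ^+ k * 2]mulrC.
by rewrite ler_wpM2r// sqr_ge0.
Qed.

Theorem proposition29 (R : realType) (P : set nat)
  (P_infinite : infinite_set P)
  (P_prime : forall p : nat, P p -> prime p) :
  (fun x : R => (countS P x)%:R : R^o)
    =o_ (+oo_ R) (fun x : R => ln x : R^o) ->
  (fun x : R => (count_le P x)%:R : R^o)
    =O_ (+oo_ R) (fun x : R => ln (ln x) : R^o).
Proof.
move=> /eqoP/(_ 1 ltr01)[Y [Yreal SY]].
apply/eqO_exP.
have ln2 : 0 < ln (2 : R) by rewrite ln_gt0// ltr1n.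
exists ((ln 2 + 2) / ln 2); first by rewrite divr_gt0// addr_gt0.
near=> x.
have x_gt1 : 1 < x by near: x; exact: nbhs_pinfty_gt.
have x_ge1 := ltW x_gt1.
have x_gt0 : 0 < x by exact: lt_trans x_gt1.
have xY : Y < x by near: x; exact: nbhs_pinfty_gt.
have x_large : expR (expR 1) <= x by near: x; exact: nbhs_pinfty_ge.
have L_ge : expR 1 <= ln x.
  by rewrite -[leLHS]expRK ler_ln ?posrE ?expR_gt0.
have L_gt0 : 0 < ln x by exact: lt_le_trans (expR_gt0 1) L_ge.
have lnL_ge1 : 1 <= ln (ln x).
  by rewrite -[leLHS]expRK ler_ln ?posrE ?expR_gt0.
rewrite !ger0_norm//; last exact: le_trans lnL_ge1.
set k := count_le P x.
(* Only for k > 0 is x ^ k at least x, hence in the range of the hypothesis. *)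
have [->|k_gt0] := posnP k.
  by rewrite mulr_ge0 ?divr_ge0 ?addr_ge0 ?ltW// (lt_le_trans _ lnL_ge1).
have kL : 2 ^+ k <= k%:R * ln x.
  have /SY : Y < x ^+ k by rewrite (lt_le_trans xY)// ler_eXnr.
  rewrite lnXn// mul1r !ger0_norm ?mulrn_wge0 ?(ltW L_gt0)//.
  rewrite mulr_natl; apply: le_trans.
  by rewrite -natrX ler_nat expn_count_le_countS.
have := @expn_le_sqr _ _ _ (ltW L_gt0) kL.
rewrite -ler_ln ?posrE ?mulr_gt0 ?exprn_gt0//.
rewrite lnM ?posrE ?exprn_gt0// !lnXn// => main.
rewrite mulrAC ler_pdivlMr// mulr_natl (le_trans main)//.
(* ln 2 + 2 * ln (ln x) is at most (ln 2 + 2) * ln (ln x), as ln (ln x) >= 1. *)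
rewrite mulrDl -[X in _ + X]mulr_natl lerD2r.
by rewrite ler_peMr// ltW.
Unshelve. all: by end_near.
Qed.
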